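(* The system $\mathsf{DG}+\mathsf{QF\text{-}AC}^{1,0}+\mathsf{PF\text{-}TP}_{\forall}$ proves $\mathsf{FAN}$. Here $\mathsf{QF\text{-}AC}^{1,0}$ is the schema $(\forall x^{1})(\exists y^{0})A(x,y)\rightarrow(\exists Y^{2})(\forall x^{1})A(x,Y(x))$ for quantifier-free internal $A$; $\mathsf{PF\text{-}TP}_{\forall}$ is the schema $(\forall^{\mathrm{st}}\underline{x})\varphi(\underline{x})\rightarrow(\forall\underline{x})\varphi(\underline{x})$ for every internal $\varphi(\underline{x})$ whose free variables are all among $\underline{x}$ (no parameters allowed); and $\mathsf{FAN}$ is $(\forall T^{1}\le 1)\big[(\forall\alpha\le_1 1)(\exists m^0)(\overline{\alpha}m\notin T)\rightarrow(\exists n^0)(\forall\beta\le_1 1)(\overline{\beta}n\notin T)\big]$.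
   Context: The variable $T^1$ ranges over (codes of) trees, i.e. characteristic functions of sets of (codes of) finite sequences closed under initial segments; $T\le_1 1$ means $T$ is a binary tree. Finite types: $0$ is a type and if $\rho,\sigma$ are types so is $\rho\to\sigma$; type $1=0\to0$, $2=1\to0$. $\mathsf{E\text{-}HA}^{\omega}$ is Heyting arithmetic in all finite types (intuitionistic logic, Gödel's $T$ constants) with extensionality. Equality $=_0$ is primitive; for $\tau=\tau_1\to\dots\to\tau_k\to0$, $x=_\tau y$ abbreviates $(\forall z_1\dots z_k)(xz_1\dots z_k=_0yz_1\dots z_k)$, and $\le_\tau$ likewise. Extensionality $(\mathsf E_{\rho\to\tau})$: $(\forall\varphi)(\forall x,y)(x=_\rho y\to\varphi(x)=_\tau\varphi(y))$, for all types. Binary sequences: $f\le_1 1$; $\overline{f}N=\langle f(0),\dots,f(N-1)\rangle$. Strong majorizability (Howard–Bezem): $x\le^*_0 y$ iff $x\le_0 y$; $x\le^*_{\rho\to\sigma}y$ iff for all $u,v$ with $u\le^*_\rho v$: $xu\le^*_\sigma yv$ and $yu\le^*_\sigma yv$. Monotone: $x\le^*x$; $\tilde\forall,\tilde\exists$ range over monotone objects. The language of $\mathsf{DG}$ adds predicates $\mathrm{st}^\sigma$ (''is standard''); $\forall^{\mathrm{st}},\exists^{\mathrm{st}}$ are the relativised quantifiers, $\tilde\forall^{\mathrm{st}},\tilde\exists^{\mathrm{st}}$ combine both restrictions. Internal = not containing $\mathrm{st}$. $\mathsf{DG}$ is $\mathsf{E\text{-}HA}^\omega$ in the extended language plus: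 (a) $x=_\sigma y\to(\mathrm{st}(x)\to\mathrm{st}(y))$; (b) $\mathrm{st}(y)\to(x\le^*_\sigma y\to\mathrm{st}(x))$; (c) $\mathrm{st}(t)$ for closed terms $t$; (d) $\mathrm{st}(z)\to(\mathrm{st}(x)\to\mathrm{st}(zx))$; external induction $\Phi(0)\wedge(\forall^{\mathrm{st}}n)(\Phi(n)\to\Phi(n+1))\to(\forall^{\mathrm{st}}n)\Phi(n)$ for any $\Phi$; and for arbitrary $\Phi,\Psi$ and internal $\phi,\psi$: $\mathsf{mAC}^\omega$: $(\tilde\forall^{\mathrm{st}}x)(\tilde\exists^{\mathrm{st}}y)\Phi(x,y)\to(\tilde\exists^{\mathrm{st}}f)(\tilde\forall^{\mathrm{st}}x)(\exists y\le^*f(x))\Phi(x,y)$; $\mathsf R^\omega$: $(\forall x)(\exists^{\mathrm{st}}y)\Phi(x,y)\to(\tilde\exists^{\mathrm{st}}z)(\forall x)(\exists y\le^*z)\Phi(x,y)$; $\mathsf I^\omega$: $(\tilde\forall^{\mathrm{st}}z)(\exists x)(\forall y\le^*z)\phi(x,y)\to(\exists x)(\forall^{\mathrm{st}}y)\phi(x,y)$; $\mathsf{IP}^\omega_{\tilde\forall^{\mathrm{st}}}$: $[(\tilde\forall^{\mathrm{st}}x)\phi(x)\to(\tilde\exists^{\mathrm{st}}y)\Psi(y)]\to(\tilde\exists^{\mathrm{st}}z)[(\tilde\forall^{\mathrm{st}}x)\phi(x)\to(\tilde\exists y\le^*z)\Psi(y)]$; $\mathsf M^\omega$: $[(\tilde\forall^{\mathrm{st}}x)\phi(x)\to\psi]\to(\tilde\exists^{\mathrm{st}}y)[(\forall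 x\le^*y)\phi(x)\to\psi]$; $\mathsf{MAJ}^\omega$: $(\forall^{\mathrm{st}}x)(\exists^{\mathrm{st}}y)(x\le^*y)$. *)

(* Defs.v *)
From Stdlib Require Import List.
Import ListNotations.

Set Implicit Arguments.
Unset Strict Implicit.
Unset Printing Implicit Defensive.

Inductive ty : Type :=
| N : ty
| Arr : ty -> ty -> ty.

Declare Scope ty_scope.
Delimit Scope ty_scope with ty.
Bind Scope ty_scope with ty.
Notation "s ⇒ t" := (Arr s t) (at level 55, right associativity) : ty_scope.

Notation ty1 := (Arr N N).
Notation ty2 := (Arr (Arr N N) N).

(* Contexts are lists of types; variables are typed de Bruijn indices, the
   head of the context being the innermost bound variable. *)

Definition ctx := list ty.

Inductive var : ctx -> ty -> Type :=
| vz : forall G s, var (s :: G) s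
| vs : forall G s t, var G s -> var (t :: G) s.

Arguments vz {G s}.
Arguments vs {G s t} _.

(* Terms of Goedel's T in its combinatory presentation. *)

Inductive tm (G : ctx) : ty -> Type :=
| Var : forall s, var G s -> tm G s
| App : forall s t, tm G (s ⇒ t)%ty -> tm G s -> tm G t
| Zero : tm G N
| Succ : tm G (N ⇒ N)%ty
| Pi : forall s t, tm G (s ⇒ t ⇒ s)%ty
| Sigma : forall r s t, tm G ((r ⇒ s ⇒ t) ⇒ (r ⇒ s) ⇒ r ⇒ t)%ty
| Rec : forall s, tm G (s ⇒ (s ⇒ N ⇒ s) ⇒ N ⇒ s)%ty.

Arguments Var {G s} _.
Arguments App {G s t} _ _.
Arguments Zero {G}.
Arguments Succ {G}.
Arguments Pi {G} s t.
Arguments Sigma {G} r s t.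
Arguments Rec {G} s.

Declare Scope tm_scope.
Delimit Scope tm_scope with tm.
Bind Scope tm_scope with tm.
Notation "f · a" := (App f a) (at level 40, left associativity) : tm_scope.
Open Scope tm_scope.

Notation v0 := (Var vz).
Notation v1 := (Var (vs vz)).
Notation v2 := (Var (vs (vs vz))).
Notation v3 := (Var (vs (vs (vs vz)))).

(* Formulas of the language with the standardness predicates; equality is
   primitive at type N only. *)

Inductive form : ctx -> Type :=
| Eq0 : forall G, tm G N -> tm G N -> form G
| St : forall G s, tm G s -> form G
| Bot : forall G, form G
| And : forall G, form G -> form G -> form G
| Or : forall G, form G -> form G -> form G
| Imp : forall G, form G -> form G -> form G
| All : forall G s, form (s :: G) -> form G
| Ex : forall G s, form (s :: G) -> form G.

Arguments Bot {G}.
Arguments All {G} s _.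
Arguments Ex {G} s _.

Declare Scope form_scope.
Delimit Scope form_scope with form.
Bind Scope form_scope with form.
Notation "A ⊓ B" := (And A B) (at level 80, right associativity) : form_scope.
Notation "A ⊔ B" := (Or A B) (at level 85, right associativity) : form_scope.
Notation "A ⊃ B" := (Imp A B) (at level 90, right associativity) : form_scope.
Open Scope form_scope.

Definition Not G (A : form G) : form G := A ⊃ Bot.

Fixpoint internal G (A : form G) : bool :=
  match A with
  | Eq0 _ _ => true
  | St _ => false
  | Bot => true
  | And A B | Or A B | Imp A B => internal A && internal B
  | All _ A | Ex _ A => internal A
  end.

Fixpoint qf G (A : form G) : bool :=
  match A with
  | Eq0 _ _ => true
  | St _ => false
  | Bot => true
  | And A B | Or A B | Imp A B => qf A && qf B
  | All _ _ | Ex _ _ => false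
  end.

Definition renaming (G D : ctx) := forall s, var G s -> var D s.
Definition substitution (G D : ctx) := forall s, var G s -> tm D s.

Definition scons (P : ty -> Type) (t : ty) (G : ctx) (a : P t)
    (f : forall s, var G s -> P s) (s : ty) (v : var (t :: G) s) : P s :=
  match v in var G' s' return
    match G' with
    | [] => unit
    | t' :: G0 => P t' -> (forall r, var G0 r -> P r) -> P s'
    end
  with
  | vz => fun a _ => a
  | vs w => fun _ f => f _ w
  end a f.

Definition up_ren G D (t : ty) (r : renaming G D) : renaming (t :: G) (t :: D) :=
  scons (P := var (t :: D)) vz (fun s v => vs (r s v)).

Definition shift G (t : ty) : renaming G (t :: G) := fun s v => vs v.
Arguments shift {G} t s _.

Fixpoint ren_tm G D (r : renaming G D) s (a : tm G s) : tm D s :=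
  match a with
  | Var v => Var (r _ v)
  | App f b => ren_tm r f · ren_tm r b
  | Zero => Zero
  | Succ => Succ
  | Pi s t => Pi s t
  | Sigma r s t => Sigma r s t
  | Rec s => Rec s
  end.

Fixpoint sub_tm G D (f : substitution G D) s (a : tm G s) : tm D s :=
  match a with
  | Var v => f _ v
  | App g b => sub_tm f g · sub_tm f b
  | Zero => Zero
  | Succ => Succ
  | Pi s t => Pi s t
  | Sigma r s t => Sigma r s t
  | Rec s => Rec s
  end.

Definition wk_tm G (t : ty) s (a : tm G s) : tm (t :: G) s :=
  ren_tm (shift t) a.
Arguments wk_tm {G t s} a.

Definition up_sub G D (t : ty) (f : substitution G D)
    : substitution (t :: G) (t :: D) :=
  scons (P := tm (t :: D)) v0 (fun s v => wk_tm (f s v)).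

Fixpoint ren G (A : form G) : forall D, renaming G D -> form D :=
  match A with
  | Eq0 a b => fun D r => Eq0 (ren_tm r a) (ren_tm r b)
  | St a => fun D r => St (ren_tm r a)
  | Bot => fun D r => Bot
  | And A B => fun D r => ren A r ⊓ ren B r
  | Or A B => fun D r => ren A r ⊔ ren B r
  | Imp A B => fun D r => ren A r ⊃ ren B r
  | All s A => fun D r => All s (ren A (up_ren (t := s) r))
  | Ex s A => fun D r => Ex s (ren A (up_ren (t := s) r))
  end.

Fixpoint sub G (A : form G) : forall D, substitution G D -> form D :=
  match A with
  | Eq0 a b => fun D f => Eq0 (sub_tm f a) (sub_tm f b)
  | St a => fun D f => St (sub_tm f a)
  | Bot => fun D f => Bot
  | And A B => fun D f => sub A f ⊓ sub B f
  | Or A B => fun D f => sub A f ⊔ sub B f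
  | Imp A B => fun D f => sub A f ⊃ sub B f
  | All s A => fun D f => All s (sub A (up_sub (t := s) f))
  | Ex s A => fun D f => Ex s (sub A (up_sub (t := s) f))
  end.

Definition wk G (t : ty) (A : form G) : form (t :: G) := ren A (shift t).
Arguments wk {G t} A.

(* Weakening by a variable just outside the innermost one, respectively the
   two innermost ones. *)
Definition wk1 G (t s : ty) (A : form (s :: G)) : form (s :: t :: G) :=
  ren A (up_ren (shift t)).
Arguments wk1 {G t s} A.
Definition wk2 G (t s r : ty) (A : form (s :: r :: G))
    : form (s :: r :: t :: G) :=
  ren A (up_ren (up_ren (shift t))).
Arguments wk2 {G t s r} A.

Definition inst G (s : ty) (A : form (s :: G)) (a : tm G s) : form G :=
  sub A (scons (P := tm G) a (fun t v => Var v)).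

Definition no_var (G : ctx) : renaming [] G :=
  fun s v => match v in var G' s' return
               match G' with [] => var G s' | _ :: _ => unit end
             with vz => tt | vs _ => tt end.
Arguments no_var {G} s v.

Definition embed_tm G s (t : tm [] s) : tm G s := ren_tm no_var t.
Definition embed G (A : form []) : form G := ren A no_var.

Definition str_var G s t (v : var (s :: G) t) : option (tm G t) :=
  scons (P := fun t => option (tm G t)) None (fun t w => Some (Var w)) v.

(* str a is Some b if a is the weakening of b, and None if v0 occurs in a. *)
Fixpoint str G s t (a : tm (s :: G) t) : option (tm G t) :=
  match a with
  | Var v => str_var v
  | App f b =>
      match str f, str b with
      | Some f', Some b' => Some (f' · b')
      | _, _ => None
      end
  | Zero => Some Zero
  | Succ => Some Succ
  | Pi r u => Some (Pi r u)
  | Sigma r u w => Some (Sigma r u w)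
  | Rec u => Some (Rec u)
  end.

Definition lam_var G s t (v : var (s :: G) t) : tm G (s ⇒ t)%ty :=
  scons (P := fun t => tm G (s ⇒ t)%ty)
    (Sigma s (s ⇒ s)%ty s · Pi s (s ⇒ s)%ty · Pi s s)
    (fun t w => Pi t s · Var w) v.

(* The constant case for applications keeps nested abstractions small. *)
Fixpoint lam G s t (a : tm (s :: G) t) : tm G (s ⇒ t)%ty :=
  match a with
  | Var v => lam_var v
  | App f b =>
      match str f, str b with
      | Some f', Some b' => Pi _ _ · (f' · b')
      | _, _ => Sigma _ _ _ · lam f · lam b
      end
  | Zero => Pi _ _ · Zero
  | Succ => Pi _ _ · Succ
  | Pi r u => Pi _ _ · Pi r u
  | Sigma r u w => Pi _ _ · Sigma r u w
  | Rec u => Pi _ _ · Rec u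
  end.

Notation "'λ' s , a" := (@lam _ s _ a)
  (at level 60, s at level 55, a at level 60, right associativity) : tm_scope.

Definition add_tm {G} : tm G (N ⇒ N ⇒ N)%ty :=
  λ N, λ N, Rec N · v1 · (λ N, λ N, Succ · v1) · v0.

Definition pred_tm {G} : tm G (N ⇒ N)%ty :=
  λ N, Rec N · Zero · (λ N, λ N, v0) · v0.

Definition monus_tm {G} : tm G (N ⇒ N ⇒ N)%ty :=
  λ N, λ N, Rec N · v1 · (λ N, λ N, pred_tm · v1) · v0.

(* tri n = 1 + 2 + ... + n *)
Definition tri_tm {G} : tm G (N ⇒ N)%ty :=
  λ N, Rec N · Zero · (λ N, λ N, add_tm · v1 · (Succ · v0)) · v0.

(* Cantor pairing, a bijection from pairs onto the natural numbers. *)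
Definition pair_tm {G} : tm G (N ⇒ N ⇒ N)%ty :=
  λ N, λ N, add_tm · (tri_tm · (add_tm · v1 · v0)) · v0.

(* Codes of finite sequences: the empty sequence is 0, and appending x to the
   sequence coded by c gives 1 + <c, x>.  Every number is the code of exactly
   one finite sequence. *)
Definition snoc_tm {G} : tm G (N ⇒ N ⇒ N)%ty :=
  λ N, λ N, Succ · (pair_tm · v1 · v0).

(* bar f n is the code of the sequence f 0, ..., f (n - 1). *)
Definition bar_tm {G} : tm G (ty1 ⇒ N ⇒ N)%ty :=
  λ ty1, λ N, Rec N · Zero · (λ N, λ N, snoc_tm · v1 · (v3 · v0)) · v0.

Definition bar G (f : tm G ty1) (n : tm G N) : tm G N := bar_tm · f · n.

Definition one {G} : tm G N := Succ · Zero.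
Definition one1 {G} : tm G ty1 := Pi N N · one.

Fixpoint eqt s : forall G, tm G s -> tm G s -> form G :=
  match s with
  | N => fun G x y => Eq0 x y
  | Arr r t => fun G x y => All r (eqt (wk_tm x · v0) (wk_tm y · v0))
  end.
Arguments eqt {s G} x y.

Definition leq0 G (x y : tm G N) : form G := Eq0 (monus_tm · x · y) Zero.

Fixpoint leqt s : forall G, tm G s -> tm G s -> form G :=
  match s with
  | N => fun G x y => leq0 x y
  | Arr r t => fun G x y => All r (leqt (wk_tm x · v0) (wk_tm y · v0))
  end.
Arguments leqt {s G} x y.

Fixpoint maj s : forall G, tm G s -> tm G s -> form G :=
  match s with
  | N => fun G x y => leq0 x y
  | Arr r t => fun G x y =>
      All r (All r (maj v1 v0 ⊃
        maj (wk_tm (wk_tm x) · v1) (wk_tm (wk_tm y) · v0) ⊓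
        maj (wk_tm (wk_tm y) · v1) (wk_tm (wk_tm y) · v0)))
  end.
Arguments maj {s G} x y.

(* Relativised quantifiers: St marks standard, M monotone, B bounded in the
   sense of strong majorizability. *)

Definition AllSt G s (A : form (s :: G)) : form G := All s (St v0 ⊃ A).
Definition ExSt G s (A : form (s :: G)) : form G := Ex s (St v0 ⊓ A).
Definition AllMSt G s (A : form (s :: G)) : form G :=
  All s (St v0 ⊓ maj v0 v0 ⊃ A).
Definition ExMSt G s (A : form (s :: G)) : form G :=
  Ex s (St v0 ⊓ maj v0 v0 ⊓ A).
Definition AllB G s (z : tm G s) (A : form (s :: G)) : form G :=
  All s (maj v0 (wk_tm z) ⊃ A).
Definition ExB G s (z : tm G s) (A : form (s :: G)) : form G :=
  Ex s (maj v0 (wk_tm z) ⊓ A).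
Definition ExMB G s (z : tm G s) (A : form (s :: G)) : form G :=
  Ex s (maj v0 v0 ⊓ maj v0 (wk_tm z) ⊓ A).

Arguments AllSt {G} s A.
Arguments ExSt {G} s A.
Arguments AllMSt {G} s A.
Arguments ExMSt {G} s A.

Definition theory := forall G, form G -> Prop.

Definition theory_union (T U : theory) : theory :=
  fun G A => T G A \/ U G A.
Notation "T ⊕ U" := (theory_union T U) (at level 50, left associativity).

Inductive nd (Th : theory) : forall G, list (form G) -> form G -> Prop :=
| nd_ax : forall G (H : list (form G)) A, Th G A -> nd Th H A
| nd_hyp : forall G (H : list (form G)) A, In A H -> nd Th H A
| nd_botE : forall G (H : list (form G)) A, nd Th H Bot -> nd Th H A
| nd_andI : forall G (H : list (form G)) A B,
    nd Th H A -> nd Th H B -> nd Th H (A ⊓ B)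
| nd_andE1 : forall G (H : list (form G)) A B, nd Th H (A ⊓ B) -> nd Th H A
| nd_andE2 : forall G (H : list (form G)) A B, nd Th H (A ⊓ B) -> nd Th H B
| nd_orI1 : forall G (H : list (form G)) A B, nd Th H A -> nd Th H (A ⊔ B)
| nd_orI2 : forall G (H : list (form G)) A B, nd Th H B -> nd Th H (A ⊔ B)
| nd_orE : forall G (H : list (form G)) A B C,
    nd Th H (A ⊔ B) -> nd Th (A :: H) C -> nd Th (B :: H) C -> nd Th H C
| nd_impI : forall G (H : list (form G)) A B,
    nd Th (A :: H) B -> nd Th H (A ⊃ B)
| nd_impE : forall G (H : list (form G)) A B,
    nd Th H (A ⊃ B) -> nd Th H A -> nd Th H B
| nd_allI : forall G s (H : list (form G)) (A : form (s :: G)),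
    nd Th (map wk H) A -> nd Th H (All s A)
| nd_allE : forall G s (H : list (form G)) (A : form (s :: G)) (t : tm G s),
    nd Th H (All s A) -> nd Th H (inst A t)
| nd_exI : forall G s (H : list (form G)) (A : form (s :: G)) (t : tm G s),
    nd Th H (inst A t) -> nd Th H (Ex s A)
| nd_exE : forall G s (H : list (form G)) (A : form (s :: G)) (B : form G),
    nd Th H (Ex s A) -> nd Th (A :: map wk H) (wk B) -> nd Th H B.

Definition proves (Th : theory) (A : form []) : Prop := nd Th [] A.

(* Induction is restricted to internal formulas, as it is the schema of
   E-HA^omega: unrestricted, it would make every number standard.  External
   formulas only obey DG_ext_ind below. *)

Inductive E_HA : theory :=
| HA_eq_refl : forall G (x : tm G N), E_HA (Eq0 x x)
| HA_eq_sym : forall G (x y : tm G N), E_HA (Eq0 x y ⊃ Eq0 y x)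
| HA_eq_trans : forall G (x y z : tm G N), E_HA (Eq0 x y ⊃ Eq0 y z ⊃ Eq0 x z)
| HA_ext : forall G r t (f : tm G (r ⇒ t)%ty) (x y : tm G r),
    E_HA (eqt x y ⊃ eqt (f · x) (f · y))
| HA_succ_nonzero : forall G (x : tm G N), E_HA (Not (Eq0 (Succ · x) Zero))
| HA_succ_inj : forall G (x y : tm G N),
    E_HA (Eq0 (Succ · x) (Succ · y) ⊃ Eq0 x y)
| HA_pi : forall G s t (x : tm G s) (y : tm G t), E_HA (eqt (Pi s t · x · y) x)
| HA_sigma : forall G r s t
    (x : tm G (r ⇒ s ⇒ t)%ty) (y : tm G (r ⇒ s)%ty) (z : tm G r),
    E_HA (eqt (Sigma r s t · x · y · z) (x · z · (y · z)))
| HA_rec_zero : forall G s (x : tm G s) (y : tm G (s ⇒ N ⇒ s)%ty),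
    E_HA (eqt (Rec s · x · y · Zero) x)
| HA_rec_succ : forall G s (x : tm G s) (y : tm G (s ⇒ N ⇒ s)%ty) (n : tm G N),
    E_HA (eqt (Rec s · x · y · (Succ · n)) (y · (Rec s · x · y · n) · n))
| HA_ind : forall G (A : form (N :: G)), internal A = true ->
    E_HA (inst A Zero ⊓ All N (A ⊃ inst (wk1 A) (Succ · v0)) ⊃ All N A).

(* In a schema with a formula A(x, y), the context of A is y :: x :: G. *)

Inductive DG : theory :=
| DG_E_HA : forall G (A : form G), E_HA A -> DG A
| DG_st_eq : forall G s (x y : tm G s), DG (eqt x y ⊃ St x ⊃ St y)
| DG_st_maj : forall G s (x y : tm G s), DG (St y ⊃ maj x y ⊃ St x)
| DG_st_closed : forall G s (t : tm [] s), DG (St (embed_tm G t))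
| DG_st_app : forall G r s (z : tm G (r ⇒ s)%ty) (x : tm G r),
    DG (St z ⊃ St x ⊃ St (z · x))
| DG_ext_ind : forall G (A : form (N :: G)),
    DG (inst A Zero ⊓ AllSt N (A ⊃ inst (wk1 A) (Succ · v0)) ⊃ AllSt N A)
| DG_mAC : forall G r s (A : form (s :: r :: G)),
    DG (AllMSt r (ExMSt s A) ⊃
        ExMSt (r ⇒ s)%ty (AllMSt r (ExB (v1 · v0) (wk2 A))))
| DG_R : forall G r s (A : form (s :: r :: G)),
    DG (All r (ExSt s A) ⊃ ExMSt s (All r (ExB v1 (wk2 A))))
| DG_I : forall G r s (A : form (s :: r :: G)), internal A = true ->
    DG (AllMSt s (Ex r (AllB v1 (wk2 A))) ⊃ Ex r (AllSt s A))
| DG_IP : forall G r s (A : form (r :: G)) (B : form (s :: G)),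
    internal A = true ->
    DG ((AllMSt r A ⊃ ExMSt s B) ⊃
        ExMSt s (wk (AllMSt r A) ⊃ ExMB v0 (wk1 B)))
| DG_M : forall G r (A : form (r :: G)) (B : form G),
    internal A = true -> internal B = true ->
    DG ((AllMSt r A ⊃ B) ⊃ ExMSt r (AllB v0 (wk1 A) ⊃ wk B))
| DG_MAJ : forall G s, DG (AllSt s (ExSt s (maj v1 v0)) : form G).

Inductive QF_AC_1_0 : theory :=
| qf_ac : forall G (A : form (N :: ty1 :: G)), qf A = true ->
    QF_AC_1_0 (All ty1 (Ex N A) ⊃
               Ex ty2 (All ty1 (inst (wk2 A) (v1 · v0)))).

Fixpoint close_all G : form G -> form [] :=
  match G with
  | [] => fun A => A
  | s :: G0 => fun A => close_all (All s A)
  end.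

Fixpoint close_all_st G : form G -> form [] :=
  match G with
  | [] => fun A => A
  | s :: G0 => fun A => close_all_st (AllSt s A)
  end.

(* The free variables of A all lie in its context D, so that quantifying over
   D leaves no parameters. *)
Inductive PF_TP_all : theory :=
| pf_tp : forall G D (A : form D), internal A = true ->
    PF_TP_all (embed G (close_all_st A ⊃ close_all A)).

Definition mem G (s : tm G N) (T : tm G ty1) : form G := Eq0 (T · s) one.

Definition char_fun G (T : tm G ty1) : form G := leqt T one1.

(* For all f, n and m <= n, if bar f n is in T then so is bar f m.  The codes
   of finite sequences are exactly the numbers bar f n, and the initial
   segments of bar f n are the bar f m with m <= n. *)
Definition tree G (T : tm G ty1) : form G :=
  char_fun T ⊓
  All ty1 (All N (All N
    (leq0 v0 v1 ⊃
     mem (bar v2 v1) (wk_tm (wk_tm (wk_tm T))) ⊃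
     mem (bar v2 v0) (wk_tm (wk_tm (wk_tm T)))))).

Definition binary_tree G (T : tm G ty1) : form G :=
  tree T ⊓
  All ty1 (All N
    (mem (bar v1 v0) (wk_tm (wk_tm T)) ⊃
     All N (leq0 (Succ · v0) v1 ⊃ leq0 (v2 · v0) one))).

Definition FAN : form [] :=
  All ty1 (binary_tree v0 ⊃
    All ty1 (leqt v0 one1 ⊃ Ex N (Not (mem (bar v1 v0) v2))) ⊃
    Ex N (All ty1 (leqt v0 one1 ⊃ Not (mem (bar v0 v1) v2)))).

(* Main.v *)
(** By [QF_AC_1_0] the hypothesis of [FAN] yields a functional [Y] with
    [bar α (Y α)] outside [T] for every binary [α]; here [α] is replaced by a
    truncation, because [α ≤ 1] is not quantifier-free.  It remains to bound an
    arbitrary [Y] on binary sequences.  This statement is internal and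
    parameter-free, so by transfer [Y] may be taken standard; then [DG_MAJ]
    provides [Y*] majorizing [Y], and [1] majorizes every binary sequence, so
    that [Y* 1] is a bound. *)

From Stdlib Require Import List.
Require Import Defs.
Import ListNotations.

Set Implicit Arguments.
Unset Strict Implicit.
Unset Printing Implicit Defensive.

(** * Renaming, substitution and weakening *)

Lemma ren_tm_comp G D E (r : renaming G D) (q : renaming D E) s (a : tm G s) :
  ren_tm q (ren_tm r a) = ren_tm (fun t v => q t (r t v)) a.
Proof. induction a; simpl; congruence. Qed.

Lemma sub_ren_tm G D E (r : renaming G D) (f : substitution D E) s (a : tm G s) :
  sub_tm f (ren_tm r a) = sub_tm (fun t v => f t (r t v)) a.
Proof. induction a; simpl; congruence. Qed.

Lemma ren_sub_tm G D E (f : substitution G D) (r : renaming D E) s (a : tm G s) :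
  ren_tm r (sub_tm f a) = sub_tm (fun t v => ren_tm r (f t v)) a.
Proof. induction a; simpl; congruence. Qed.

Lemma sub_tm_Var G s (a : tm G s) : sub_tm (fun t v => Var v) a = a.
Proof. induction a; simpl; congruence. Qed.

Lemma ren_tm_wk G D (r : renaming G D) t s (a : tm G s) :
  ren_tm (up_ren (t := t) r) (wk_tm a) = wk_tm (ren_tm r a).
Proof. unfold wk_tm; rewrite !ren_tm_comp; reflexivity. Qed.

Lemma sub_tm_wk G D (f : substitution G D) t s (a : tm G s) :
  sub_tm (up_sub (t := t) f) (wk_tm a) = wk_tm (sub_tm f a).
Proof. unfold wk_tm; rewrite sub_ren_tm, ren_sub_tm; reflexivity. Qed.

Lemma inst_tm_wk G t (b : tm G t) s (a : tm G s) :
  sub_tm (scons (P := tm G) b (fun t v => Var v)) (wk_tm a) = a.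
Proof. unfold wk_tm; rewrite sub_ren_tm; exact (sub_tm_Var a). Qed.

(** [eqt] recurses on the type, so at a variable type it does not compute under a renaming;
    induction on the type is required. *)
Lemma ren_eqt s G D (r : renaming G D) (x y : tm G s) :
  ren (eqt x y) r = eqt (ren_tm r x) (ren_tm r y).
Proof.
  revert G D r x y; induction s as [|s _ t IH]; intros; simpl; [reflexivity|].
  f_equal. rewrite IH; simpl. rewrite !ren_tm_wk. reflexivity.
Qed.

Lemma sub_eqt s G D (f : substitution G D) (x y : tm G s) :
  sub (eqt x y) f = eqt (sub_tm f x) (sub_tm f y).
Proof.
  revert G D f x y; induction s as [|s _ t IH]; intros; simpl; [reflexivity|].
  f_equal. rewrite IH; simpl. rewrite !sub_tm_wk. reflexivity.
Qed.

Ltac name_hyps X :=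
  match goal with |- nd _ ?H _ => set (X := H) end.

(** * Equality at all finite types, in any theory containing [E_HA] *)

Section Derivations.

Variable Th : theory.
Hypothesis Th_E_HA : forall G (A : form G), E_HA A -> Th A.

Notation "H ⊢ A" := (@nd Th _ H A) (at level 95, no associativity).

Lemma nd_E_HA G (H : list (form G)) A : E_HA A -> H ⊢ A.
Proof. intros; apply nd_ax, Th_E_HA; assumption. Qed.

Lemma nd_eqt_app_fun G (H : list (form G)) s t (f g : tm G (s ⇒ t)%ty) a :
  H ⊢ eqt f g -> H ⊢ eqt (f · a) (g · a).
Proof.
  intros E. apply (nd_allE a) in E. unfold inst in E.
  rewrite sub_eqt in E; simpl in E. rewrite !inst_tm_wk in E. exact E.
Qed.

Lemma nd_eqt_app_arg G (H : list (form G)) s t (f : tm G (s ⇒ t)%ty) a b :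
  H ⊢ eqt a b -> H ⊢ eqt (f · a) (f · b).
Proof. apply nd_impE, nd_E_HA, HA_ext. Qed.

(** Carries an assumed equation of functions under the binder of its pointwise form, reducing
    symmetry and transitivity to the result type. *)
Lemma nd_eqt_hyp_wk G (H : list (form G)) r t (x y : tm G (r ⇒ t)%ty) :
  In (eqt x y) H ->
  map wk H ⊢ eqt (wk_tm x · v0) (wk_tm y · v0).
Proof.
  intros I. apply nd_eqt_app_fun, nd_hyp.
  unfold wk_tm; rewrite <- ren_eqt. exact (in_map wk _ _ I).
Qed.

Lemma nd_eqt_refl s G (H : list (form G)) (x : tm G s) : H ⊢ eqt x x.
Proof.
  revert G H x; induction s; intros; simpl.
  - apply nd_E_HA, HA_eq_refl.
  - apply nd_allI; auto.
Qed.

(** As an implication the equation sits among the hypotheses, which [nd_allI] weakens; a rule form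
    would call for weakening whole derivations in the induction. *)
Lemma nd_eqt_sym_imp s G (H : list (form G)) (x y : tm G s) :
  H ⊢ (eqt x y ⊃ eqt y x).
Proof.
  revert G H x y; induction s as [|r _ t IH]; intros.
  - apply nd_E_HA, HA_eq_sym.
  - apply nd_impI, nd_allI. eapply nd_impE; [apply IH|].
    apply nd_eqt_hyp_wk; left; reflexivity.
Qed.

Lemma nd_eqt_trans_imp s G (H : list (form G)) (x y z : tm G s) :
  H ⊢ (eqt x y ⊃ eqt y z ⊃ eqt x z).
Proof.
  revert G H x y z; induction s as [|r _ t IH]; intros.
  - apply nd_E_HA, HA_eq_trans.
  - apply nd_impI, nd_impI, nd_allI.
    eapply nd_impE; [eapply nd_impE; [apply IH|]|]; apply nd_eqt_hyp_wk.
    + right; left; reflexivity.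
    + left; reflexivity.
Qed.

Lemma nd_eqt_sym s G (H : list (form G)) (x y : tm G s) :
  H ⊢ eqt x y -> H ⊢ eqt y x.
Proof. apply nd_impE, nd_eqt_sym_imp. Qed.

Lemma nd_eqt_trans s G (H : list (form G)) (x y z : tm G s) :
  H ⊢ eqt x y -> H ⊢ eqt y z -> H ⊢ eqt x z.
Proof.
  intros E F. eapply nd_impE; [|exact F].
  eapply nd_impE; [apply nd_eqt_trans_imp | exact E].
Qed.

Lemma nd_eqt_app G (H : list (form G)) s t (f g : tm G (s ⇒ t)%ty) a b :
  H ⊢ eqt f g -> H ⊢ eqt a b -> H ⊢ eqt (f · a) (g · b).
Proof.
  intros E F. eapply nd_eqt_trans.
  - apply nd_eqt_app_fun, E.
  - apply nd_eqt_app_arg, F.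
Qed.

Lemma nd_Pi G (H : list (form G)) s t (x : tm G s) (y : tm G t) :
  H ⊢ eqt (Pi s t · x · y) x.
Proof. apply nd_E_HA, HA_pi. Qed.

Lemma nd_Sigma G (H : list (form G)) r s t (x : tm G (r ⇒ s ⇒ t)%ty) y z :
  H ⊢ eqt (Sigma r s t · x · y · z) (x · z · (y · z)).
Proof. apply nd_E_HA, HA_sigma. Qed.

Lemma nd_Rec_zero G (H : list (form G)) s (x : tm G s) y :
  H ⊢ eqt (Rec s · x · y · Zero) x.
Proof. apply nd_E_HA, HA_rec_zero. Qed.

Lemma nd_Rec_succ G (H : list (form G)) s (x : tm G s) y n :
  H ⊢ eqt (Rec s · x · y · (Succ · n)) (y · (Rec s · x · y · n) · n).
Proof. apply nd_E_HA, HA_rec_succ. Qed.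

(* The right-hand side of the goal is an evar, which becomes the normal form. *)
Ltac head_step :=
  first [ apply nd_Pi | apply nd_Sigma | apply nd_Rec_zero | apply nd_Rec_succ
        | apply nd_eqt_app_fun; head_step ].
Ltac normal_form :=
  repeat (eapply nd_eqt_trans; [head_step |]);
  lazymatch goal with
  | |- _ ⊢ eqt (_ · _) _ =>
      eapply nd_eqt_trans; [normal_args |];
      (* A normalised argument may expose [Zero] or [Succ] and so unlock a [Rec] at the head. *)
      tryif (eapply nd_eqt_trans; [head_step |]) then normal_form
      else apply nd_eqt_refl
  | _ => apply nd_eqt_refl
  end
with normal_args :=
  lazymatch goal with
  | |- _ ⊢ eqt (_ · _) _ => eapply nd_eqt_app; [normal_args | normal_form]
  | _ => apply nd_eqt_refl
  end.
Ltac conversion :=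
  match goal with |- ?H ⊢ Eq0 ?x ?y => change (H ⊢ eqt x y) | _ => idtac end;
  cbv -[eqt];
  eapply nd_eqt_trans; [normal_form | apply nd_eqt_sym; normal_form].

(** * Truncation to binary sequences, and their common majorant *)

Lemma nd_leq0_one_one G (H : list (form G)) : H ⊢ leq0 one one.
Proof. unfold leq0. conversion. Qed.

Lemma nd_monus_succ_one G (H : list (form G)) n :
  H ⊢ Eq0 (monus_tm · (Succ · n) · one) n.
Proof. conversion. Qed.

(* The truncation of a sequence is min(-, 1) pointwise, which is the sign
   function on numbers. *)
Definition sg_tm {G} : tm G (N ⇒ N)%ty :=
  Rec N · Zero · (Pi ty1 N · (Pi N N · one)).

Definition trunc_tm {G} : tm G (ty1 ⇒ ty1)%ty := Sigma N N N · (Pi ty1 N · sg_tm).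

Lemma nd_sg_zero G (H : list (form G)) : H ⊢ Eq0 (sg_tm · Zero) Zero.
Proof. conversion. Qed.

Lemma nd_sg_succ G (H : list (form G)) n : H ⊢ Eq0 (sg_tm · (Succ · n)) one.
Proof. conversion. Qed.

Lemma nd_trunc_app G (H : list (form G)) x n :
  H ⊢ Eq0 (trunc_tm · x · n) (sg_tm · (x · n)).
Proof. conversion. Qed.

Lemma nd_one1_app G (H : list (form G)) n : H ⊢ Eq0 (one1 · n) one.
Proof. conversion. Qed.

Lemma nd_leq0_eq G (H : list (form G)) x x' y y' :
  H ⊢ Eq0 x x' -> H ⊢ Eq0 y y' -> H ⊢ leq0 x' y' -> H ⊢ leq0 x y.
Proof.
  intros E F L.
  refine (nd_eqt_trans (s := N) _ L).
  apply (nd_eqt_app (s := N) (t := N)); [|exact F].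
  apply nd_eqt_app_arg, E.
Qed.

(** Serves as the case distinction between zero and successor; it comes from induction, hence the
    restriction to internal [A]. *)
Lemma nd_cases G (H : list (form G)) (A : form (N :: G)) :
  internal A = true ->
  H ⊢ inst A Zero -> map wk H ⊢ (A ⊃ inst (wk1 A) (Succ · v0)) -> H ⊢ All N A.
Proof.
  intros I Z S. eapply nd_impE; [apply nd_E_HA, HA_ind, I|].
  apply nd_andI; [exact Z | apply nd_allI, S].
Qed.

Lemma nd_sg_le_one G (H : list (form G)) n : H ⊢ leq0 (sg_tm · n) one.
Proof.
  assert (A : H ⊢ All N (leq0 (sg_tm · v0) one)).
  { apply nd_cases; [reflexivity | | apply nd_impI].
    - apply nd_leq0_eq with (x' := Zero) (y' := one);
        [apply nd_sg_zero | apply (nd_eqt_refl (s := N)) | unfold leq0; conversion].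
    - apply nd_leq0_eq with (x' := one) (y' := one);
        [apply nd_sg_succ | apply (nd_eqt_refl (s := N)) | apply nd_leq0_one_one]. }
  exact (nd_allE n A).
Qed.

Lemma nd_sg_id G (H : list (form G)) n :
  H ⊢ leq0 n one -> H ⊢ Eq0 (sg_tm · n) n.
Proof.
  assert (A : H ⊢ All N (leq0 v0 one ⊃ Eq0 (sg_tm · v0) v0)).
  { apply nd_cases; [reflexivity | |].
    - apply nd_impI, nd_sg_zero.
    - apply nd_impI, nd_impI.
      name_hyps H'.
      assert (L : H' ⊢ Eq0 (monus_tm · (Succ · v0) · one) Zero)
        by (apply nd_hyp; left; reflexivity).
      change (H' ⊢ eqt (sg_tm · (Succ · v0)) (Succ · v0)).
      eapply nd_eqt_trans; [apply nd_sg_succ|].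
      (* Both sides are successors, so [Zero = v0] remains: [L] says that the predecessor of
         [Succ · v0] is zero. *)
      apply (nd_eqt_app_arg (s := N) (t := N)).
      eapply nd_eqt_trans; [apply nd_eqt_sym, L | apply nd_monus_succ_one]. }
  intros L. exact (nd_impE (nd_allE n A) L).
Qed.

Lemma nd_trunc_le_one G (H : list (form G)) x : H ⊢ leqt (trunc_tm · x) one1.
Proof.
  apply nd_allI. eapply nd_leq0_eq.
  - apply nd_trunc_app.
  - apply nd_one1_app.
  - apply nd_sg_le_one.
Qed.

Lemma nd_trunc_id G (H : list (form G)) :
  H ⊢ All ty1 (leqt v0 one1 ⊃ eqt (trunc_tm · v0) v0).
Proof.
  apply nd_allI, nd_impI, nd_allI.
  eapply (nd_eqt_trans (s := N)); [apply nd_trunc_app|].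
  apply nd_sg_id.
  eapply nd_leq0_eq.
  - apply (nd_eqt_refl (s := N)).
  - apply (nd_eqt_sym (s := N)), nd_one1_app with (n := v0).
  - refine (nd_allE (A := leq0 (v2 · v0) (one1 · v0)) v0 _).
    apply nd_hyp; left; reflexivity.
Qed.

(** As [one1] is constant, a bound on [f u] by its value at [u] is also one by its value at any [v]
    above [u]. *)
Lemma nd_maj_one1 G (H : list (form G)) :
  H ⊢ All ty1 (leqt v0 one1 ⊃ maj v0 one1).
Proof.
  apply nd_allI, nd_impI, nd_allI, nd_allI, nd_impI, nd_andI.
  - eapply nd_leq0_eq.
    + apply (nd_eqt_refl (s := N)).
    + eapply (nd_eqt_trans (s := N)); [apply nd_one1_app|].
      apply (nd_eqt_sym (s := N)), nd_one1_app with (n := v1).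
    + refine (nd_allE (A := leq0 (Var (vs (vs (vs vz))) · v0) (one1 · v0)) v1 _).
      apply nd_hyp; right; left; reflexivity.
  - eapply nd_leq0_eq; [apply nd_one1_app.. | apply nd_leq0_one_one].
Qed.

End Derivations.

(** * Bounding functionals on binary sequences, and the fan theorem *)

Notation Th := (DG ⊕ QF_AC_1_0 ⊕ PF_TP_all).

Lemma Th_E_HA G (A : form G) : E_HA A -> Th A.
Proof. intros; left; left; apply DG_E_HA; assumption. Qed.

Lemma Th_DG G (A : form G) : DG A -> Th A.
Proof. intros; left; left; assumption. Qed.

(** The bound is not claimed to be standard: this keeps the matrix internal, as transfer demands. *)
Lemma nd_bounded_st G (H : list (form G)) :
  nd Th H (AllSt ty2 (Ex N (All ty1 (leqt v0 one1 ⊃ leq0 (v2 · v0) v1)))).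
Proof.
  apply nd_allI, nd_impI.
  name_hyps H1.
  assert (M : nd Th H1 (ExSt ty2 (maj v1 v0))).
  { refine (nd_impE (nd_allE (A := St v0 ⊃ ExSt ty2 (maj v1 v0)) v0 _) _).
    - apply nd_ax, Th_DG, DG_MAJ.
    - apply nd_hyp; left; reflexivity. }
  refine (nd_exE M _).
  (* Here [v0] is the majorant of the functional supplied by [DG_MAJ]. *)
  apply nd_exI with (t := v0 · one1).
  apply nd_allI, nd_impI.
  name_hyps H2.
  assert (M2 : nd Th H2 (maj v2 v1))
    by (eapply nd_andE2, nd_hyp; right; left; reflexivity).
  assert (B : nd Th H2 (maj v0 one1)).
  { refine (nd_impE (nd_allE (A := leqt v0 one1 ⊃ maj v0 one1) v0 _) _).
    - apply (nd_maj_one1 Th_E_HA).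
    - apply nd_hyp; left; reflexivity. }
  (* The first conjunct of [maj] at the pair [β], [one1] reads [Y β ≤ Y* one1]. *)
  exact (nd_andE1 (nd_impE (nd_allE one1 (nd_allE v0 M2)) B)).
Qed.

Lemma nd_bounded G (H : list (form G)) :
  nd Th H (All ty2 (Ex N (All ty1 (leqt v0 one1 ⊃ leq0 (v2 · v0) v1)))).
Proof.
  refine (nd_impE _ (nd_bounded_st H)).
  apply nd_ax; right.
  (* The functional is the only free variable; the tree does not occur, so there are no
     parameters. *)
  exact (@pf_tp G [ty2] (Ex N (All ty1 (leqt v0 one1 ⊃ leq0 (v2 · v0) v1))) eq_refl).
Qed.

Theorem theorem3p6 : proves (DG ⊕ QF_AC_1_0 ⊕ PF_TP_all) FAN.
Proof.
  apply nd_allI, nd_impI, nd_impI.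
  name_hyps H1.
  assert (Y : nd Th H1 (Ex ty2 (All ty1
      (Not (mem (bar (trunc_tm · v0) (v1 · v0)) v2))))).
  { refine (nd_impE (nd_ax _ (or_introl (or_intror
      (@qf_ac [ty1] (Not (mem (bar (trunc_tm · v1) v0) v2)) eq_refl)))) _).
    apply nd_allI.
    (* The hypothesis of [FAN] is taken at the truncation, which is binary for every sequence. *)
    refine (nd_impE (nd_allE
      (A := leqt v0 one1 ⊃ Ex N (Not (mem (bar v1 v0) v3))) (trunc_tm · v0) _) _).
    - apply nd_hyp; left; reflexivity.
    - apply (nd_trunc_le_one Th_E_HA). }
  refine (nd_exE Y _).
  name_hyps H2.
  refine (nd_exE (nd_allE v0 (nd_bounded H2)) _).
  apply nd_exI with (t := v0).
  apply nd_allI, nd_impI, nd_impI.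
  name_hyps H3.
  (* The context is [β], the bound [n], [Y], [T]. *)
  assert (L : nd Th H3 (leqt v0 one1))
    by (apply nd_hyp; right; left; reflexivity).
  assert (B : nd Th H3 (leq0 (v2 · v0) v1)).
  { refine (nd_impE (nd_allE (A := leqt v0 one1 ⊃ leq0 (v3 · v0) v2) v0 _) L).
    apply nd_hyp; do 2 right; left; reflexivity. }
  (* Closure of [T] under initial segments brings membership down from length [n] to [Y β ≤ n]. *)
  assert (P : nd Th H3 (mem (bar v0 (v2 · v0)) v3)).
  { assert (T : nd Th H3 (binary_tree v3))
      by (apply nd_hyp; do 5 right; left; reflexivity).
    refine (nd_impE (nd_impE (nd_allE (v2 · v0) (nd_allE v1 (nd_allE v0
      (nd_andE2 (nd_andE1 T))))) B) _).
    apply nd_hyp; left; reflexivity. }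
  assert (E : nd Th H3 (eqt (trunc_tm · v0) v0)).
  { refine (nd_impE (nd_allE v0 (nd_trunc_id Th_E_HA H3)) L). }
  refine (nd_impE (nd_allE (A := Not (mem (bar (trunc_tm · v0) (v3 · v0))
                                         (Var (vs (vs (vs (vs vz))))))) v0 _) _).
  - apply nd_hyp; do 3 right; left; reflexivity.
  (* The length is [Y β] in both formulas, so only the sequence changes, from [β] to its truncation,
     by extensionality. *)
  - refine (nd_eqt_trans Th_E_HA (s := N) _ P).
    apply (nd_eqt_app_arg Th_E_HA (s := N) (t := N)).
    apply (nd_eqt_app_fun (s := N) (t := N)).
    apply (nd_eqt_app_arg Th_E_HA), E.
Qed.
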